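(* Let $(X,\mathcal D)$ be a multimetric space (endowed with its canonical topology) and let $\mathcal F$ be a function system on $X$ which is eventually contracting with respect to $\mathcal D$. Then the following conditions are equivalent: (1) $\mathcal F$ is topologically contracting; (2) $\mathcal F$ is compactly contracting; (3) $\mathcal F$ is locally contracting; (4) $\mathcal F$ has an attractor; (5) $\mathcal F$ is compact-dominating; (6) there is a non-empty compact subset $K\subset X$ such that $\mathcal F(K)\subset K$. Moreover, the equivalent conditions (1)--(6) hold if the multimetric space $(X,\mathcal D)$ is sequentially complete.
   Context: All spaces are non-empty. $\omega=\{0,1,2,\dots\}$. A multimetric on a set $X$ is a family $\mathcal D$ of pseudometrics on $X$ such that for any distinct $x,y\in X$ there is $d\in\mathcal D$ with $d(x,y)>0$; $(X,\mathcal D)$ is then called a multimetric space. Its canonical topology is the smallest topology on $X$ in which all $d\in\mathcal D$ are continuous: $U\subset X$ is open iff for every $x\in U$ there are $\varepsilon>0$ and a finite $\mathcal E\subset\mathcal D$ with $\bigcap_{d\in\mathcal E}\{y:d(x,y)<\varepsilon\}\subset U$. A sequence in $X$ is Cauchy if it is $d$-Cauchy for every $d\in\mathcal D$; $(X,\mathcal D)$ is sequentially complete if every Cauchy sequence converges in $X$. A function system on a topological space $X$ is a non-empty finite family $\mathcal F$ of continuous maps $X\to X$. Put $\mathcal F^0=\{\mathrm{id}_X\}$, $\mathcal F^{n+1}=\{f\circ g: f\in\mathcal F,\ g\in\mathcal F^n\}$, $\mathcal F^{\ge k}=\bigcup_{n\ge k}\mathcal F^n$, and $\mathcal F(A)=\bigcup_{f\in\mathcal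 F}f(A)$ for $A\subset X$. $\mathcal K(X)$ is the space of non-empty compact subsets of $X$ with the Vietoris topology (generated by the subbase of sets $\{K:K\cap U\neq\emptyset\}$ and $\{K:K\subset U\}$, $U\subset X$ open). $\mathcal F$ induces the map $\mathcal K(X)\to\mathcal K(X)$, $K\mapsto\mathcal F(K)$, whose $n$-th iterate is $K\mapsto\mathcal F^n(K)$. An attractor of $\mathcal F$ is a set $A\in\mathcal K(X)$ with $\mathcal F(A)=A$ such that for every $K\in\mathcal K(X)$ the sequence $(\mathcal F^n(K))_{n\ge1}$ converges to $A$ in $\mathcal K(X)$. $\mathcal F$ is compact-dominating if each compact $C\subset X$ is contained in a compact $K\subset X$ with $\mathcal F(K)\subset K$. $\mathcal F$ is topologically contracting if it is compact-dominating and for every non-empty compact $K\subset X$ with $\mathcal F(K)\subset K$ and every sequence $(f_n)_{n\in\omega}\in\mathcal F^\omega$ the intersection $\bigcap_{n\in\omega}f_0\circ\dots\circ f_n(K)$ is a singleton. For families of sets, $\mathcal U\prec\mathcal V$ means that each $U\in\mathcal U$ is contained in some $V\in\mathcal V$. $\mathcal F$ is compactly contracting if $\mathcal F(C)\subset C$ for some non-empty compact $C\subset X$ and for every compact $K\subset X$ and every open cover $\mathcal U$ of $X$ there is $n\in\omega$ with $\{f(K):f\in\mathcal F^{\ge n}\}\prec\mathcal U$. $\mathcal F$ is locally contracting if $\mathcal F(C)\subset C$ for some non-empty compact $C\subset X$ and for every compact $K\subset X$ and every open cover $\mathcal U$ of $X$ there are a neighborhood $O_K$ of $K$ in $X$ and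 $n\in\omega$ with $\{f(O_K):f\in\mathcal F^{\ge n}\}\prec\mathcal U$. For a pseudometric $d$ and a family $\mathcal G$ of self-maps of $X$, $d\omega_{\mathcal G}(t)=\sup\{d(g(x),g(y)): g\in\mathcal G,\ x,y\in X,\ d(x,y)\le t\}\in[0,\infty]$ for $t\in[0,\infty]$. $\mathcal F$ is eventually contracting with respect to $\mathcal D$ if $\lim_{n\to\infty}d\omega_{\mathcal F^n}(t)=0$ for every $d\in\mathcal D$ and every real $t>0$. *)

(* Defs.v *)
From HB Require Import structures.
From mathcomp Require Import all_boot all_order all_algebra.
From mathcomp Require Import all_classical all_reals all_analysis.

Set Implicit Arguments.
Unset Strict Implicit.
Unset Printing Implicit Defensive.

Import Order.TTheory GRing.Theory Num.Theory.
Import numFieldNormedType.Exports.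

Local Open Scope classical_set_scope.
Local Open Scope ring_scope.

Record pseudometric (R : realType) (X : Type) (d : X -> X -> R) : Prop := {
  pseudometric_ge0 : forall x y, 0 <= d x y;
  pseudometric_refl : forall x, d x x = 0;
  pseudometric_sym : forall x y, d x y = d y x;
  pseudometric_triangle : forall x y z, d x z <= d x y + d y z }.

Record multimetric (R : realType) (X : Type) (D : set (X -> X -> R)) : Prop := {
  multimetric_pseudo : forall d, D d -> pseudometric d;
  multimetric_separating : forall x y, x <> y -> exists2 d, D d & 0 < d x y }.

(* A property of the topology already carried by [X]: its open sets are exactly
   those of the smallest topology making every [d] in [D] continuous. *)
Definition canonical_topology (R : realType) (X : topologicalType)
    (D : set (X -> X -> R)) : Prop :=
  forall U : set X, open U <->
    forall x, U x -> exists2 e : R, 0 < e &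
      exists E : set (X -> X -> R), [/\ finite_set E, E `<=` D &
        \bigcap_(d in E) [set y | d x y < e] `<=` U].

Definition cauchy_for (R : realType) (X : Type) (d : X -> X -> R)
    (u : nat -> X) : Prop :=
  forall e : R, 0 < e -> exists N : nat, forall m n : nat,
    (N <= m)%N -> (N <= n)%N -> d (u m) (u n) < e.

Definition sequentially_complete (R : realType) (X : topologicalType)
    (D : set (X -> X -> R)) : Prop :=
  forall u : nat -> X, (forall d, D d -> cauchy_for d u) ->
    exists x : X, u @ \oo --> x.

Record function_system (X : topologicalType) := FunctionSystem {
  fs_set :> set (X -> X);
  fs_nonempty : fs_set !=set0;
  fs_finite : finite_set fs_set;
  fs_continuous : forall f, fs_set f -> continuous f }.

Definition family_image (X : Type) (G : set (X -> X)) (A : set X) : set X :=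
  \bigcup_(f in G) (f @` A).

Fixpoint family_pow (X : Type) (G : set (X -> X)) (n : nat) : set (X -> X) :=
  match n with
  | 0 => [set id]
  | m.+1 => [set f \o g | f in G & g in family_pow G m]
  end.

Definition family_pow_ge (X : Type) (G : set (X -> X)) (k : nat) :
    set (X -> X) :=
  \bigcup_(n in [set n | (k <= n)%N]) family_pow G n.

Section FunctionSystemPowers.
Variables (X : topologicalType) (F : function_system X) (n : nat).

Lemma family_pow_nonempty : family_pow F n !=set0.
Proof.
elim: n => [|m [g Gg]] /=; first by exists id.
by have [f Ff] := fs_nonempty F; exists (f \o g), f => //; exists g.
Qed.

Lemma family_pow_finite : finite_set (family_pow F n).
Proof.
elim: n => [|m IH] /=; first exact: finite_set1.
by apply: finite_image2 IH; exact: fs_finite.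
Qed.

Lemma family_pow_continuous f : family_pow F n f -> continuous f.
Proof.
elim: n f => [|m IH] f /=; first by move=> -> x; exact: cvg_id.
move=> [g Fg [h Fh <-]] x; apply: continuous_comp; first exact: IH.
exact: (fs_continuous Fg).
Qed.

Definition fs_pow : function_system X :=
  FunctionSystem family_pow_nonempty family_pow_finite family_pow_continuous.

End FunctionSystemPowers.

Record hyperspace (X : topologicalType) := Hyperspace {
  hyper_set :> set X;
  hyper_nonempty : hyper_set !=set0;
  hyper_compact : compact hyper_set }.

HB.instance Definition _ (X : topologicalType) := gen_eqMixin (hyperspace X).
HB.instance Definition _ (X : topologicalType) :=
  gen_choiceMixin (hyperspace X).

Definition vietoris_subbase (X : topologicalType) : set (set (hyperspace X)) :=
  [set [set K : hyperspace X | K `&` U !=set0] | U in open] `|`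
  [set [set K : hyperspace X | K `<=` U] | U in open].

HB.instance Definition _ (X : topologicalType) :=
  isSubBaseTopological.Build (hyperspace X) (@vietoris_subbase X) id.

Section HyperImage.
Variables (X : topologicalType) (F : function_system X) (K : hyperspace X).

Lemma family_image_nonempty : family_image F K !=set0.
Proof.
have [f Ff] := fs_nonempty F; have [x Kx] := hyper_nonempty K.
by exists (f x), f => //; exists x.
Qed.

Lemma family_image_compact : compact (family_image F K).
Proof.
rewrite /family_image -bigsetU_fset_set; last exact: fs_finite.
rewrite big_seq; apply: bigsetU_compact => f.
rewrite in_fset_set; last exact: fs_finite.
rewrite inE => Ff; apply: continuous_compact; last exact: hyper_compact.
by apply: continuous_subspaceT; exact: fs_continuous Ff.
Qed.

Definition hyper_image : hyperspace X :=
  Hyperspace family_image_nonempty family_image_compact.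

End HyperImage.

Definition is_attractor (X : topologicalType) (F : function_system X)
    (A : hyperspace X) : Prop :=
  family_image F A = A /\
  forall K : hyperspace X,
    (fun n : nat => hyper_image (fs_pow F n) K) @ \oo --> A.

Definition has_attractor (X : topologicalType) (F : function_system X) : Prop :=
  exists A : hyperspace X, is_attractor F A.

Definition has_invariant_compact (X : topologicalType)
    (F : function_system X) : Prop :=
  exists K : set X, [/\ K !=set0, compact K & family_image F K `<=` K].

Definition compact_dominating (X : topologicalType)
    (F : function_system X) : Prop :=
  forall C : set X, compact C ->
    exists K : set X, [/\ compact K, C `<=` K & family_image F K `<=` K].

(* [comp_upto f n] is f_0 o ... o f_n. *)
Fixpoint comp_upto (X : Type) (f : nat -> X -> X) (n : nat) : X -> X :=
  match n with
  | 0 => f 0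
  | m.+1 => comp_upto f m \o f m.+1
  end.

Definition topologically_contracting (X : topologicalType)
    (F : function_system X) : Prop :=
  compact_dominating F /\
  forall K : set X, K !=set0 -> compact K -> family_image F K `<=` K ->
  forall f : nat -> X -> X, (forall n, fs_set F (f n)) ->
  exists x : X, \bigcap_n (comp_upto f n @` K) = [set x].

Definition refines (X : Type) (U V : set (set X)) : Prop :=
  forall A, U A -> exists2 B, V B & A `<=` B.

Definition open_cover (X : topologicalType) (U : set (set X)) : Prop :=
  U `<=` open /\ \bigcup_(A in U) A = setT.

Definition compactly_contracting (X : topologicalType)
    (F : function_system X) : Prop :=
  has_invariant_compact F /\
  forall (K : set X) (U : set (set X)), compact K -> open_cover U ->
  exists n : nat, refines [set f @` K | f in family_pow_ge F n] U.

Definition locally_contracting (X : topologicalType)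
    (F : function_system X) : Prop :=
  has_invariant_compact F /\
  forall (K : set X) (U : set (set X)), compact K -> open_cover U ->
  exists2 O : set X, set_nbhs K O &
  exists n : nat, refines [set f @` O | f in family_pow_ge F n] U.

(* The supremum is never over the empty set for non-empty [X] and [G] and
   [0 <= t] (take [x = y]), so it then lies in [0, +oo]. *)
Definition modulus (R : realType) (X : Type) (d : X -> X -> R)
    (G : set (X -> X)) (t : \bar R) : \bar R :=
  ereal_sup [set s | exists g x y,
    [/\ G g, ((d x y)%:E <= t)%E & s = (d (g x) (g y))%:E]].

Definition eventually_contracting (R : realType) (X : topologicalType)
    (D : set (X -> X -> R)) (F : function_system X) : Prop :=
  forall d, D d -> forall t : R, 0 < t ->
    (fun n : nat => modulus d (family_pow F n) t%:E) @ \oo --> 0%E.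

(* Main.v *)
Require Import Defs.
From HB Require Import structures.
From mathcomp Require Import all_boot all_order all_algebra.
From mathcomp Require Import all_classical all_reals all_analysis.
Local Open Scope classical_set_scope.
Local Open Scope ring_scope.

Set Implicit Arguments.
Unset Strict Implicit.
Unset Printing Implicit Defensive.

Import Order.TTheory GRing.Theory Num.Theory.

(** Every condition gives a non-empty compact set [K0] with [F(K0) <= K0]: it is
    part of compact and of local contraction, an attractor is one, and domination
    of a singleton provides one.  So it suffices to recover everything from such
    a [K0], and to build one when the space is sequentially complete.

    From [K0] to local contraction
    ([invariant_compact_locally_contracting]).  Fix [k] in [K0].  Any [g] in a
    high power of [F] maps a given [d]-bounded set into a small [d]-ball around
    [g k], which lies in [K0].  Hence images of a compact [K]
    shrink towards points of the fixed compact set [K0], and compactness of [K0]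
    makes finitely many pseudometrics, one exponent and one neighborhood of [K]
    suffice for a given open cover.  Local contraction is stronger than compact
    contraction.

    From compact contraction to the rest.  Only the Hausdorff property is used,
    always through a cover by two open sets
    ([compactly_contracting_dichotomy]): for large [n], the image of a compact
    set under any [g] in [F^n] lies in one of the two.
    - With the cover [{U, ~K0}], where [K0 <= U], the sets [F^n(C)] end up in [U]
      ([invariant_compact_absorbs]); so [K0] together with all [F^n(C)] is compact
      and invariant, which is domination.
    - With the cover [{~x, ~y}], two distinct points cannot both lie in all
      [f_0 o ... o f_n (K)].
    - The attractor is the intersection [A] of the decreasing sequence [F^n(K0)].
      Upper convergence is absorption, lower convergence at [a] in [A] is the
      cover [{U, ~a}].

    The sequentially complete case ([complete_invariant_compact]).  Take a point
    [x0].  Orbits of [x0] under all powers of [F] are bounded for each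
    pseudometric ([orbit_bound]), which makes the sequences
    [f_0 o ... o f_n (x0)] Cauchy, uniformly in [(f_n)].  Their limits define a
    continuous map on the compact space of sequences in the finite set [F], and
    its image is compact and invariant.  Passing through the code space is what
    lets sequential completeness suffice, since the topology of [X] need not be
    determined by sequences. *)

(** * Powers of a family of maps and iterated compositions *)

Section Powers.
Context {T : Type} (G : set (T -> T)).

Lemma family_pow_comp m n f g :
  family_pow G m f -> family_pow G n g -> family_pow G (m + n)%N (f \o g).
Proof.
elim: m f => [|m IH] f /=; first by move=> ->.
move=> [a Ga [b Gb <-]] Gg; exists a => //.
by exists (b \o g); first exact: IH.
Qed.

Lemma family_pow_split m n h : family_pow G (m + n)%N h ->
  exists f g, [/\ family_pow G m f, family_pow G n g & h = f \o g].
Proof.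
elim: m h => [|m IH] h /=; first by exists id, h.
move=> [a Ga [b /IH[f [g [Gf Gg ->]]] <-]].
by exists (a \o f), g; split => //; exists a => //; exists f.
Qed.

Lemma family_pow_image m n A :
  family_image (family_pow G (m + n)%N) A =
  family_image (family_pow G m) (family_image (family_pow G n) A).
Proof.
rewrite eqEsubset; split => [y|y].
  case=> h /family_pow_split[f [g [Gf Gg ->]]] [x Ax <-].
  by exists f => //; exists (g x) => //; exists g => //; exists x.
case=> f Gf [_ [g Gg [x Ax <-]] <-].
by exists (f \o g); [exact: family_pow_comp|exists x].
Qed.

Lemma family_pow1 : family_pow G 1 = G.
Proof.
rewrite eqEsubset; split => [_ [g Gg [_ -> <-]] //|f Gf].
by exists f => //; exists id.
Qed.

Lemma family_imageS (A B : set T) :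
  A `<=` B -> family_image G A `<=` family_image G B.
Proof. by move=> AB y [f Gf [x /AB Bx <-]]; exists f => //; exists x. Qed.

Lemma comp_upto_pow f n :
  (forall i, G (f i)) -> family_pow G n.+1 (comp_upto f n).
Proof.
move=> Gf; elim: n => [|n IH] /=; first by exists (f 0) => //; exists id.
have Gfn : family_pow G 1 (f n.+1) by rewrite family_pow1.
by have := family_pow_comp IH Gfn; rewrite addn1.
Qed.

Lemma comp_upto_add f n k : (forall i, G (f i)) ->
  exists2 g, family_pow G k g & comp_upto f (n + k) = comp_upto f n \o g.
Proof.
move=> Gf; elim: k => [|k [g Gg E]]; first by exists id => //; rewrite addn0.
exists (g \o f (n + k).+1); last by rewrite addnS /= E.
have Gfn : family_pow G 1 (f (n + k).+1) by rewrite family_pow1.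
by have := family_pow_comp Gg Gfn; rewrite addn1.
Qed.

Lemma eq_comp_upto (f g : nat -> T -> T) n :
  (forall i, (i <= n)%N -> f i = g i) -> comp_upto f n = comp_upto g n.
Proof.
elim: n => [|n IH] fg /=; first by rewrite fg.
by rewrite fg// IH// => i /leqW; exact: fg.
Qed.

Lemma comp_upto_cons (f : T -> T) g n :
  comp_upto (fun i => if i is j.+1 then g j else f) n.+1 = f \o comp_upto g n.
Proof. by elim: n => [//|n IH]; rewrite [LHS]/= -/(comp_upto _ n.+1) IH. Qed.

Lemma family_pow_invariant n A :
  family_image G A `<=` A -> family_image (family_pow G n) A `<=` A.
Proof.
move=> GA; elim: n => [|n IH]; first by move=> y [_ -> [x Ax <-]].
rewrite -add1n family_pow_image family_pow1.
exact: subset_trans (family_imageS IH) GA.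
Qed.

End Powers.

(** * Compact sets, open covers and the Vietoris topology *)

Section Topology.
Context {X : topologicalType}.

(** A point outside [U] is outside some [K m], hence a whole neighborhood of it is
    outside all later [K n]; compactness of [K 0] makes one [n] work everywhere. *)
Lemma nested_compact_sub (K : nat -> set X) (U : set X) :
  compact (K 0) -> (forall n, closed (K n)) -> (forall n, K n.+1 `<=` K n) ->
  open U -> \bigcap_n K n `<=` U -> exists n, K n `<=` U.
Proof.
move=> cK0 clK Kdec oU KU.
have Kle m n : (m <= n)%N -> K n `<=` K m.
  move=> /subnK <-; elim: (n - m)%N => [//|k IH].
  exact: subset_trans (Kdec _) IH.
have /compact_near_coveringP/(_ nat \oo (fun n x => K n x -> U x)) := cK0.
case => [x K0x|n _ /(_ n (leqnn n)) KnU].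
- have [Ux|nUx] := pselect (U x).
    exists (U, setT); last by move=> [y n] [/= Uy _].
    by split; [exact: open_nbhs_nbhs|exact: filterT].
  have [m nKm] : exists m, ~ K m x.
    by apply/existsNP => Kx; apply/nUx/KU => m _; exact: Kx.
  exists (~` K m, [set n | (m <= n)%N]).
    split; last by exists m.
    by apply: open_nbhs_nbhs; split => //; exact: closed_openC.
  by move=> [y n] [/= nKy mn] /(Kle _ _ mn).
by exists n => x Knx; apply: (KnU x) => //; exact: (Kle 0%N) Knx.
Qed.

Lemma nested_compact_nonempty (K : nat -> set X) :
  compact (K 0) -> (forall n, closed (K n)) -> (forall n, K n.+1 `<=` K n) ->
  (forall n, K n !=set0) -> \bigcap_n K n !=set0.
Proof.
move=> cK clK Kdec K0; apply/set0P/eqP => I0.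
have [|n Kn] := nested_compact_sub cK clK Kdec (@open0 X); first by rewrite I0.
by have [x /Kn] := K0 n.
Qed.

Lemma open_cover2 (U V : set X) :
  open U -> open V -> U `|` V = setT -> open_cover [set U; V].
Proof.
move=> oU oV UV; split=> [_ [->|->]//|].
by rewrite bigcup_setU !bigcup_set1.
Qed.

(** Convergence has to be checked on the subbase only, whose two kinds of sets are
    the two hypotheses. *)
Lemma cvg_hyperspace (u : nat -> hyperspace X) (A : hyperspace X) :
  (forall U, open U -> A `&` U !=set0 -> \forall n \near \oo, u n `&` U !=set0) ->
  (forall U, open U -> A `<=` U -> \forall n \near \oo, u n `<=` U) ->
  u @ \oo --> A.
Proof.
move=> uhit usub W /=; rewrite nbhsE.
move=> [_ [[B sB <-] [C BC CA]] BW].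
apply: (@filterS _ _ _ (u @^-1` C)) => [n Cn|]; first by apply: BW; exists C.
have /sB [D sD CE] := BC; rewrite -CE.
apply: (@filter_bigI _ _ D id (u @ \oo)) => V DV.
have AV : V A by move: CA; rewrite -CE; apply.
by have /sD := DV; rewrite inE => -[] [U oU VE]; move: AV; rewrite -VE /=;
  [exact: uhit|exact: usub].
Qed.

(** Allowing the empty set avoids bundling [K] as a point of the hyperspace. *)
Lemma compact_family_image (F : function_system X) (K : set X) :
  compact K -> compact (family_image F K).
Proof.
have [->|/set0P K0] := eqVneq K set0.
  move=> _; suff -> : family_image F set0 = set0 by exact: compact0.
  by rewrite -subset0 => y [f _ [x]].
by move=> cK; exact: (@family_image_compact _ F (Hyperspace K0 cK)).
Qed.

End Topology.

Lemma locally_compactly_contracting (X : topologicalType)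
    (F : function_system X) :
  locally_contracting F -> compactly_contracting F.
Proof.
move=> [F6 Floc]; split => // K U cK Ucov.
have [W KW [n HW]] := Floc K U cK Ucov; exists n => _ [g Fg <-].
have [V UV gV] := HW (g @` W) (ex_intro2 _ _ g Fg erefl).
exists V => // _ [x Kx <-]; apply: gV; exists x => //.
exact: nbhs_singleton (KW x Kx).
Qed.

(** * Compactly contracting systems on Hausdorff spaces *)

Section CompactlyContracting.
Context {X : topologicalType} (F : function_system X).
Hypothesis hX : hausdorff_space X.
Hypothesis Fcc : compactly_contracting F.

Let closed_point (x : X) : closed [set x].
Proof. exact/accessible_closed_set1/hausdorff_accessible. Qed.

(** Covers by two open sets carry all applications of compact contraction below. *)
Lemma compactly_contracting_dichotomy (K U V : set X) :
  compact K -> open U -> open V -> U `|` V = setT ->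
  exists N, forall n g, (N <= n)%N -> family_pow F n g ->
    g @` K `<=` U \/ g @` K `<=` V.
Proof.
move=> cK oU oV UV; have [N HN] := Fcc.2 K _ cK (open_cover2 oU oV UV).
exists N => n g Nn Fg.
have [|W [->|->] gW] := HN (g @` K); [|by left|by right].
by exists g => //; exists n.
Qed.

(** Apply the dichotomy to [{U, ~K}] and to the compact set [K `|` C]: its image
    under [g] in [F^n] meets [K] by invariance, so it cannot lie in [~K]. *)
Lemma invariant_compact_absorbs (K C U : set X) :
  K !=set0 -> compact K -> family_image F K `<=` K ->
  compact C -> open U -> K `<=` U ->
  exists N, forall n, (N <= n)%N -> family_image (family_pow F n) C `<=` U.
Proof.
move=> [k Kk] cK FK cC oU KU.
have [|N HN] := compactly_contracting_dichotomy (compactU cK cC) oU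
  (closed_openC (compact_closed hX cK)).
  by rewrite eqEsubset; split => // x _; have [/KU|] := pselect (K x);
    [left|right].
exists N => n Nn y [g Fg [x Cx <-]].
have [gU|gK] := HN n g Nn Fg; first by apply: gU; exists x => //; right.
have /gK : (g @` (K `|` C)) (g k) by exists k => //; left.
by case; apply: (family_pow_invariant (n := n) FK); exists g => //; exists k.
Qed.

(** Add to an invariant compact [K0] all the sets [F^n(C)].  A filter on the union
    without cluster point in [K0] avoids a neighborhood of [K0], by compactness
    of [K0]; that neighborhood absorbs almost all [F^n(C)], so the filter lives
    on a finite union of compact sets. *)
Lemma compactly_contracting_dominating : compact_dominating F.
Proof.
have [K0 [K0n cK0 FK0]] := Fcc.1.
move=> C cC; pose O := \bigcup_n family_image (family_pow F n) C.
have cO n : compact (family_image (family_pow F n) C).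
  exact: (@compact_family_image _ (fs_pow F n)).
exists (K0 `|` O); split.
- move=> G PG GK; apply: contrapT => nclG.
  have nclK0 x : K0 x -> ~ cluster G x.
    by move=> Kx clx; apply: nclG; exists x; split => //; left.
  (* Some member [W] of [G] has its closure disjoint from [K0]. *)
  have := iffLR (compact_near_coveringP K0) cK0 _ (powerset_filter_from G)
    (fun W x => ~ closure W x).
  case=> [x /nclK0 /existsNP [A /existsNP [B /not_implyP [GA]]]|M [MG _ [W MW]]].
    move=> /not_implyP [xB /set0P/negP/negPn/eqP AB].
    exists (B^°, [set W | G W /\ W `<=` A]) => [|[y W] [/= By [_ WA]] cly].
      by split; [exact: nbhs_interior|exact: powerset_filter_fromP].
    have [z [Wz Bz]] := cly _ By.
    by have : set0 z by rewrite -AB; split; first exact: WA.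
  move=> /(_ W MW) K0W; have GW := MG _ MW.
  have [|N HN] := invariant_compact_absorbs K0n cK0 FK0 cC _ K0W.
    exact: closed_openC (@closed_closure _ W).
  have cE : compact (\bigcup_(n < N) family_image (family_pow F n) C).
    by rewrite bigcup_mkord; apply: bigsetU_compact.
  have [|x [[n _ Fnx] clx]] := cE G PG.
    apply: filterS (filterI GK GW) => x [[K0x|[n _ Fnx]] Wx].
      by have /K0W := K0x; case; exact: subset_closure.
    exists n => //=; rewrite ltnNge; apply/negP => Nn.
    by have := HN n Nn x Fnx; case; exact: subset_closure.
  by apply: nclG; exists x; split => //; right; exists n.
- by move=> x Cx; right; exists 0%N => //; exists id => //; exists x.
- move=> y [f Ff [x [K0x|[n _ Fnx]] <-]].
    by left; apply: FK0; exists f => //; exists x.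
  right; exists n.+1 => //.
  by rewrite -add1n family_pow_image family_pow1; exists f => //; exists x.
Qed.

Lemma compactly_contracting_topologically : topologically_contracting F.
Proof.
split; first exact: compactly_contracting_dominating.
move=> K Kn cK FK f Ff.
have fP n : family_pow F n.+1 (comp_upto f n) by exact: comp_upto_pow.
have cfK n : compact (comp_upto f n @` K).
  apply: continuous_compact => //; apply: continuous_subspaceT.
  exact: (family_pow_continuous (fP n)).
have [x Ix] : \bigcap_n (comp_upto f n @` K) !=set0.
  apply: nested_compact_nonempty => //.
  - by move=> n; exact: compact_closed.
  - move=> n _ [y Ky <-] /=; exists (f n.+1 y) => //.
    by apply: FK; exists (f n.+1) => //; exists y.
  - by move=> n; have [y Ky] := Kn; exists (comp_upto f n y), y.
exists x; rewrite eqEsubset; split=> [y Iy|_ ->//].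
apply: contrapT => yx.
have [|N HN] := compactly_contracting_dichotomy cK
    (closed_openC (@closed_point x)) (closed_openC (@closed_point y)).
  rewrite eqEsubset; split => // z _.
  by have [->|] := pselect (z = x); [right => /= xy; exact: yx|left].
have [/(_ _ (Ix N I))|/(_ _ (Iy N I))] := HN _ _ (leqnSn N) (fP N); exact.
Qed.

(** The attractor is the intersection [A] of the decreasing compact sets
    [L n = F^n(K)], for an invariant compact [K]. *)
Lemma compactly_contracting_attractor : has_attractor F.
Proof.
have [K [Kn cK FK]] := Fcc.1.
pose L n := family_image (family_pow F n) K.
have L0 : L 0 = K.
  by rewrite eqEsubset; split=> [y [_ -> [x Kx <-]]//|x Kx];
    exists id => //; exists x.
have cL n : compact (L n) by exact: (@compact_family_image _ (fs_pow F n)).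
have clL n : closed (L n) by exact: compact_closed.
have LS n : L n.+1 = family_image F (L n).
  by rewrite /L -add1n family_pow_image family_pow1.
have Ldec n : L n.+1 `<=` L n.
  rewrite /L -addn1 family_pow_image family_pow1; exact: family_imageS.
have Ln n : L n !=set0.
  elim: n => [|n [x Lx]]; first by rewrite L0.
  have [f Ff] := fs_nonempty F.
  by exists (f x); rewrite LS; exists f => //; exists x.
pose A := \bigcap_n L n.
have AK : A `<=` K by move=> x /(_ 0%N I); rewrite L0.
have An : A !=set0 by exact: nested_compact_nonempty.
have cA : compact A.
  by apply: (subclosed_compact _ cK AK); exact: closed_bigI.
have Asub U : open U -> A `<=` U -> exists n, L n `<=` U.
  exact: nested_compact_sub.
have FA : family_image F A `<=` A.
  move=> y [f Ff [x Ax <-]] n _; apply: Ldec; rewrite LS.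
  by exists f => //; exists x => //; exact: Ax.
exists (Hyperspace An cA); split => /=.
  rewrite eqEsubset; split=> // a Aa; apply: contrapT => nFa.
  (* If [a] is not in [F(A)], then [A] is inside the open set [V] of points that
     no map of [F] sends to [a]; some [L n] is also inside [V], and so
     [L n.+1 = F(L n)] misses [a]. *)
  pose V := \bigcap_(f in fs_set F) f @^-1` (~` [set a]).
  have oV : open V.
    rewrite /V -bigsetI_fset_set; last exact: fs_finite.
    rewrite big_seq; apply: big_ind => //; [exact: openT|exact: openI|].
    move=> f; rewrite in_fset_set ?inE; last exact: fs_finite.
    move=> Ff; apply: open_comp; last exact/closed_openC/closed_point.
    by move=> x _; exact: fs_continuous Ff x.
  have AV : A `<=` V.
    by move=> x Ax f Ff /= fxa; apply: nFa; rewrite -fxa; exists f => //; exists x.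
  have [n LV] := Asub _ oV AV.
  have := Aa n.+1 I; rewrite LS => -[f Ff [x /LV Vx fxa]].
  exact: (Vx _ Ff fxa).
move=> M; have cM := @hyper_compact _ M.
apply: cvg_hyperspace => /= U oU.
  (* [a] is [g x] for some [g] in [F^n], so the image of [K `|` M] under this [g]
     cannot avoid [a] and lies in [U]. *)
  move=> [a [Aa Ua]].
  have [|N HN] := compactly_contracting_dichotomy (compactU cK cM) oU
     (closed_openC (@closed_point a)).
    rewrite eqEsubset; split => // z _.
    by have [->|] := pselect (z = a); [left|right].
  exists N => // n Nn; have [g Fg [x Kx gxa]] := Aa n I.
  have [y My] := hyper_nonempty M.
  have [gU|gA] := HN n g Nn Fg.
    exists (g y); split; first by exists g => //; exists y.
    by apply: gU; exists y => //; right.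
  by have /gA [] : (g @` (K `|` M)) a by exists x => //; left.
(* [L p] is itself an invariant compact set, so it absorbs [M]. *)
move=> AU; have [p LpU] := Asub _ oU AU.
have LpF : family_image F (L p) `<=` L p by rewrite -LS.
have [N HN] := invariant_compact_absorbs (Ln p) (cL p) LpF cM oU LpU.
by exists N.
Qed.

End CompactlyContracting.

(** * Eventually contracting systems on multimetric spaces *)

Lemma filter_bigI_finite (I : choiceType) T (E : set I) (f : I -> set T)
    (G : set_system T) : Filter G -> finite_set E ->
  (forall i, E i -> G (f i)) -> G (\bigcap_(i in E) f i).
Proof.
move=> FG finE Gf; rewrite -(fset_setK finE); apply: filter_bigI => i.
by rewrite in_fset_set// inE; exact: Gf.
Qed.

Section Multimetric.
Context {R : realType} {X : topologicalType} (D : set (X -> X -> R)).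
Hypothesis D_multimetric : multimetric D.
Hypothesis X_canonical : canonical_topology D.

Let tri d : D d -> forall x y z, d x z <= d x y + d y z.
Proof. by move=> /(multimetric_pseudo D_multimetric)/pseudometric_triangle. Qed.
Let sym d : D d -> forall x y, d x y = d y x.
Proof. by move=> /(multimetric_pseudo D_multimetric)/pseudometric_sym. Qed.
Let refl d : D d -> forall x, d x x = 0.
Proof. by move=> /(multimetric_pseudo D_multimetric)/pseudometric_refl. Qed.

Lemma open_mball d x e : D d -> open [set y | d x y < e].
Proof.
move=> Dd; apply/X_canonical => y /= xye; exists (e - d x y).
  by rewrite subr_gt0.
exists [set d]; split=> [|_ ->//|z /(_ d erefl) /= yz]; first exact: finite_set1.
by rewrite (le_lt_trans (tri Dd x y z))// -ltrBrDl.
Qed.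

Lemma nbhs_mball d x e : D d -> 0 < e -> nbhs x [set y | d x y < e].
Proof.
by move=> Dd e0; apply: open_nbhs_nbhs; split; [exact: open_mball|rewrite /= refl].
Qed.

(** Only finitely many pseudometrics enter a basic neighborhood, and a filter is
    stable under finite intersections. *)
Lemma cvg_multimetric (G : set_system X) x : Filter G ->
  (forall d e, D d -> 0 < e -> \forall y \near G, d x y < e) -> G --> x.
Proof.
move=> FG Gx U; rewrite nbhsE => -[V [oV Vx] VU].
have [e e0 [E [finE ED EV]]] := iffLR (X_canonical V) oV x Vx.
apply: filterS VU _; apply: filterS EV _.
by apply: filter_bigI_finite => // d /ED Dd; exact: Gx.
Qed.

Lemma multimetric_hausdorff : hausdorff_space X.
Proof.
move=> p q clpq; apply: contrapT => pq.
have [d Dd d0] := multimetric_separating D_multimetric pq.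
have d20 : 0 < d p q / 2 by rewrite divr_gt0.
have [z [/= pz qz]] := clpq _ _ (nbhs_mball p Dd d20) (nbhs_mball q Dd d20).
have := tri Dd p z q; rewrite leNgt (sym Dd z) => /negP; apply.
by rewrite [ltRHS](splitr (d p q)) ltrD.
Qed.

Lemma compact_dbounded d x K : D d -> compact K ->
  exists T, forall y, K y -> d x y < T.
Proof.
move=> Dd cK.
have := iffLR (compact_near_coveringP K) cK _ (pinfty_nbhs R)
  (fun T y => d x y < T).
case=> [y Ky|M [_ HM]].
  exists ([set z | d y z < 1], [set T | d x y + 1 < T]).
    split; [exact: nbhs_mball|exists (d x y + 1)].
    by split => //; exact: num_real.
  move=> [z T] [/= yz xyT]; apply: le_lt_trans xyT.
  by rewrite (le_trans (tri Dd x y z))// lerD2l ltW.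
by exists (M + 1); apply: HM; rewrite ltrDl.
Qed.

Variable F : function_system X.
Hypothesis F_contracting : eventually_contracting D F.

Lemma eventually_contracting_lt d t e : D d -> 0 < e ->
  exists N, forall n g x y, (N <= n)%N -> family_pow F n g ->
    d x y <= t -> d (g x) (g y) < e.
Proof.
move=> Dd e0; have t0 : 0 < Num.max t 1 by rewrite lt_max ltr01 orbT.
have := F_contracting Dd t0.
move=> /(_ [set s | (s < e%:E)%E]) /=.
case=> [|N _ HN].
  apply: open_nbhs_nbhs; split; last by rewrite /= lte_fin.
  exact: open_ereal_lt_ereal.
exists N => n g x y Nn Fg xyt; rewrite -lte_fin.
apply: le_lt_trans (HN n Nn).
apply: ereal_sup_ubound; exists g, x, y; split => //.
by rewrite lee_fin le_max xyt.
Qed.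

(** Compactness of [K0] is applied to the filter of pairs [(n, O)] with [n] large
    and [O] a small neighborhood of [K0 `|` K], and to the property that any [g]
    in [F^n] sending the base point [k] to [z] maps [O] into a member of the
    cover.  The neighborhood [O] has to be part of the index because it depends
    on the pseudometrics used near [z]. *)
Lemma invariant_compact_locally_contracting :
  has_invariant_compact F -> locally_contracting F.
Proof.
move=> Fic; split => //; have [K0 [[k K0k] cK0 FK0]] := Fic.
move=> K U cK [Uo Ucov].
have cKK := compactU cK0 cK; set L := K0 `|` K in cKK.
have Ln : L !=set0 by exists k; left.
pose P (nO : nat * set X) z := forall g, family_pow F nO.1 g -> g k = z ->
  exists2 V, U V & g @` nO.2 `<=` V.
have PF : ProperFilter (powerset_filter_from (set_nbhs L)).
  exact/powerset_filter_from_filter/set_nbhs_pfilter.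
have := iffLR (compact_near_coveringP K0) cK0 _
   (filter_prod \oo (powerset_filter_from (set_nbhs L))) P.
case=> [x K0x|[A M] [[N _ NA] [M' [M'L _ [W M'W]] M'M]] AM].
  have [V UV Vx] : (\bigcup_(A in U) A) x by rewrite Ucov.
  have [e e0 [E [finE ED EV]]] := iffLR (X_canonical V) (Uo _ UV) x Vx.
  have QP : \bigcap_(d in E) [set zi : X * (nat * set X) |
      forall g, family_pow F zi.2.1 g -> g k = zi.1 ->
        forall y, zi.2.2 y -> d x (g y) < e] `<=` [set zi | P zi.2 zi.1].
    move=> [z i] Qz g Fg gkz; exists V => // _ [y Oy <-]; apply: EV => d Ed.
    exact: (Qz d Ed g Fg gkz).
  apply: filterS QP _; apply: filter_bigI_finite => // d /ED Dd.
  (* For one [d]: [O] is taken inside a [d]-ball around [k], so that [g @` O] is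
     within [e / 2] of [g k = z], which is itself within [e / 2] of [x]. *)
  have [T LT] := compact_dbounded k Dd cKK.
  have e20 : 0 < e / 2 by rewrite divr_gt0.
  have [N HN] := eventually_contracting_lt T Dd e20.
  pose S := [set O | set_nbhs L O /\ O `<=` [set y | d k y < T]].
  exists ([set z | d x z < e / 2], [set n | (N <= n)%N] `*` S).
    split; first exact: nbhs_mball.
    exists ([set n | (N <= n)%N], S) => //.
    split; first by exists N.
    apply: powerset_filter_fromP => y /LT dy.
    by apply: open_nbhs_nbhs; split => //; exact: open_mball.
  move=> [z [n O]] [xz [Nn [_ OT]]] g Fg gkz y Oy; rewrite -gkz in xz.
  rewrite (splitr e) (le_lt_trans (tri Dd x (g k) _))// ltrD//.
  by apply: HN Nn Fg _; exact/ltW/OT.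
exists W; first by move=> x Kx; apply: M'L => //; right.
exists N => _ [g [n /= Nn Fg] <-].
apply: (AM (n, W)) erefl => //=; first by split; [exact: NA|exact: M'M].
by apply: (family_pow_invariant (n := n) FK0); exists g => //; exists k.
Qed.

Lemma finite_orbit_bound d x N : D d ->
  exists M, forall n g, (n < N)%N -> family_pow F n g -> d x (g x) < M.
Proof.
move=> Dd; have cE : compact (\bigcup_(n < N) family_image (fs_pow F n) [set x]).
  rewrite bigcup_mkord; apply: bigsetU_compact => n _.
  exact/compact_family_image/compact_set1.
have [M HM] := compact_dbounded x Dd cE; exists M => n g nN Fg.
by apply: HM; exists n => //; exists g => //; exists x.
Qed.

(** The modulus of a small power may be infinite, so the bound cannot come from
    summing the steps of an orbit.  Choose [N] such that high powers from
    [F^N] on map points at distance at most 2 to points at distance less than 1,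
    then [n0] such that [g b x] is within 1 of [g x] for [g] in [F^n], [n >= n0],
    and [b] in [F^N].  Then each orbit point is within 2 of one of the finitely
    many orbit points of length less than [n0 + N]: induction on the length,
    stripping the outer [N] maps [g1], replacing the inner orbit point by an
    early one [g' x], and if [g1 \o g'] is too long, dropping its innermost [N]
    maps [b]. *)
Lemma orbit_bound d x : D d ->
  exists C, forall n g, family_pow F n g -> d x (g x) < C.
Proof.
move=> Dd.
have [N0 HN0] := eventually_contracting_lt 2 Dd (@ltr01 R).
(* [N] has to be positive for the strong induction to progress. *)
pose N := N0.+1.
have [M HM] := finite_orbit_bound x N.+1 Dd.
have [n0 Hn0] := eventually_contracting_lt M Dd (@ltr01 R).
have [L HL] := finite_orbit_bound x (n0 + N) Dd.
suff H n g : family_pow F n g -> exists k g',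
    [/\ (k < n0 + N)%N, family_pow F k g' & d (g' x) (g x) <= 2].
  exists (L + 2) => n g /H[k [g' [kn Fg' gg']]].
  by rewrite (le_lt_trans (tri Dd x (g' x) _))// ltr_leD// (HL k).
elim/ltn_ind: n g => n IH g Fg.
have [nlt|nge] := ltnP n (n0 + N); first by exists n, g; rewrite refl.
have Nn : (N <= n)%N by rewrite (leq_trans _ nge)// leq_addl.
move: Fg; rewrite -(subnKC Nn) => /family_pow_split[g1 [g2 [Fg1 Fg2 ->]]].
have [|k [g' [kn Fg' gg']]] := IH (n - N)%N _ g2 Fg2.
  by rewrite ltn_subrL (leq_trans _ Nn).
have d1 : d (g1 (g' x)) (g1 (g2 x)) < 1 by apply: HN0 Fg1 gg'; rewrite leqnSn.
have Fk : family_pow F (N + k) (g1 \o g') by exact: family_pow_comp.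
have [kn0|kn0] := ltnP k n0.
  exists (N + k)%N, (g1 \o g'); split => //; first by rewrite addnC ltn_add2r.
  by rewrite /= (le_trans (ltW d1))// ler1n.
move: Fk; rewrite addnC => /family_pow_split[a [b [Fa Fb ab]]].
exists k, a; split => //=.
rewrite (le_trans (tri Dd _ (a (b x)) _))// -[2]/(1 + 1) lerD//.
  apply/ltW; apply: (Hn0 k _ x (b x) kn0 Fa).
  exact: ltW (HM N b (ltnSn N) Fb).
by rewrite -[a (b x)]/((a \o b) x) -ab ltW.
Qed.

(** With [m <= n] the two points are [g x] and [g (b x)] for the same [g] in
    [F^m.+1], and [d x (b x)] is bounded; so the estimate is uniform in the
    sequence of maps. *)
Lemma comp_upto_cauchy d x e : D d -> 0 < e ->
  exists N, forall f m n, (forall i, fs_set F (f i)) ->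
    (N <= m)%N -> (m <= n)%N -> d (comp_upto f m x) (comp_upto f n x) < e.
Proof.
move=> Dd e0; have [C HC] := orbit_bound x Dd.
have [N HN] := eventually_contracting_lt C Dd e0.
exists N => f m n Ff Nm mn.
have [g Fg] := comp_upto_add m (n - m) Ff; rewrite subnKC// => ->.
apply: HN (comp_upto_pow m Ff) _; first exact: leqW.
exact/ltW/(HC _ _ Fg).
Qed.

End Multimetric.

(** * The sequentially complete case and the theorem *)

(** The space of codes is [nat -> nat] with the product topology, restricted to
    sequences bounded by the length of a list [s] of the maps of [F]; it is
    compact by Tychonoff's theorem.  A code [c] is sent to the limit [p c] of
    [f_0 o ... o f_n (x0)], where [f_i] is the [c i]-th map of [s].  The map [p]
    is continuous because [p c] is determined up to [e] for [d] by finitely many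
    entries of [c], uniformly in [c].  Its image is invariant because a map [f]
    of [F] sends [p c] to the limit of the code obtained by putting the index of
    [f] in front of [c]. *)
Lemma complete_invariant_compact (R : realType) (X : topologicalType)
    (D : set (X -> X -> R)) (F : function_system X) :
  [set: X] !=set0 -> multimetric D -> canonical_topology D ->
  eventually_contracting D F -> sequentially_complete D ->
  has_invariant_compact F.
Proof.
move=> [x0 _] Dmm Dcan Fec Dcomp.
have hX := multimetric_hausdorff Dmm Dcan.
have [f0 Ff0] := fs_nonempty F.
have /finite_seqP[s Fs] := fs_finite F.
(* The default value [f0] makes every integer the index of a map of [F], so that
   all codes, and not only the bounded ones, have a limit. *)
pose h i := nth f0 s i.
have Fh i : fs_set F (h i).
  have [si|si] := ltnP i (size s); last by rewrite /h nth_default.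
  by rewrite Fs /=; exact: mem_nth.
pose u (c : nat -> nat) n := comp_upto (h \o c) n x0.
have uC d e : D d -> 0 < e -> exists N, forall c m n,
    (N <= m)%N -> (m <= n)%N -> d (u c m) (u c n) < e.
  move=> Dd e0; have [N HN] := comp_upto_cauchy Dmm Dcan Fec x0 Dd e0.
  by exists N => c m n; apply: HN => i; exact: Fh.
have sym d : D d -> forall x y, d x y = d y x.
  by move=> /(multimetric_pseudo Dmm)/pseudometric_sym.
have tri d : D d -> forall x y z, d x z <= d x y + d y z.
  by move=> /(multimetric_pseudo Dmm)/pseudometric_triangle.
have ulim : forall c : nat -> nat, exists x : X, u c @ \oo --> x.
  move=> c; apply: Dcomp => d Dd e e0; have [N HN] := uC d e Dd e0.
  exists N => m n Nm Nn; have [mn|/ltnW nm] := leqP m n; first exact: HN.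
  by rewrite sym//; exact: HN.
have [p up] := choice ulim.
have up_unif d e : D d -> 0 < e -> exists N, forall c, d (u c N) (p c) < e.
  move=> Dd e0; have e20 : 0 < e / 2 by rewrite divr_gt0.
  have [N HN] := uC d _ Dd e20; exists N => c.
  have [M _ HM] := up c _ (nbhs_mball Dmm Dcan (p c) Dd e20).
  rewrite (splitr e) (le_lt_trans (tri d Dd _ (u c (maxn N M)) _))// ltrD//.
    by apply: HN; rewrite ?leq_maxl.
  by rewrite sym//; apply: HM; rewrite /= leq_maxr.
have pcont : continuous (p : {ptws nat -> nat} -> X).
  move=> c; apply: (cvg_multimetric Dcan) => d e Dd e0.
  have e20 : 0 < e / 2 by rewrite divr_gt0.
  have [N HN] := up_unif d _ Dd e20.
  have cN : nbhs c (\bigcap_(i in `I_N.+1) [set c' : nat -> nat | c' i = c i]).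
    apply: filter_bigI_finite => [|i _]; first exact: finite_II.
    exact: (@proj_continuous nat (fun=> nat) i c _ (discrete_set1 (c i))).
  apply: filterS cN => c' /= cc'.
  rewrite (splitr e) (le_lt_trans (tri d Dd _ (u c N) _))// ltrD//.
    by rewrite sym.
  have -> // : u c N = u c' N.
  rewrite /u; congr (_ x0); apply: eq_comp_upto => i iN /=.
  by rewrite (cc' i).
exists (p @` [set c | forall i, `I_(size s) (c i)]); split.
- exists (p (fun=> index f0 s)), (fun=> index f0 s) => // i /=.
  by rewrite index_mem; move: Ff0; rewrite Fs.
- apply: (@continuous_compact {ptws nat -> nat} X p).
    exact: continuous_subspaceT.
  apply: (@tychonoff nat (fun=> nat) (fun=> `I_(size s))) => _.
  exact/finite_compact/finite_II.
move=> _ [f Ff [_ [c cs <-] <-]].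
have fs : f \in s by move: Ff; rewrite Fs.
pose c' i := if i is j.+1 then c j else index f s.
exists c'; first by case=> [|i] /=; [rewrite index_mem|exact: cs].
have uS : u c' \o addn 1 = f \o u c.
  apply/funext => n /=; rewrite add1n.
  rewrite /u -[RHS]/((f \o comp_upto (h \o c) n) x0) -comp_upto_cons.
  congr (comp_upto _ _ _); apply/funext => -[|i] //=.
  by rewrite /h nth_index.
have fup : f \o u c @ \oo --> f (p c).
  exact: continuous_cvg (fs_continuous Ff (x:=p c)) (up c).
apply: (cvg_unique hX) fup; rewrite -uS.
exact: cvg_comp (cvg_addnl 1) (up c').
Qed.

Theorem theorem5p6 (R : realType) (X : topologicalType)
    (D : set (X -> X -> R)) (F : function_system X)
    (X_nonempty : [set: X] !=set0)
    (D_multimetric : multimetric D)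
    (X_canonical : canonical_topology D)
    (F_contracting : eventually_contracting D F) :
  [<-> topologically_contracting F;
       compactly_contracting F;
       locally_contracting F;
       has_attractor F;
       compact_dominating F;
       has_invariant_compact F] /\
  (sequentially_complete D ->
   topologically_contracting F /\
   compactly_contracting F /\
   locally_contracting F /\
   has_attractor F /\
   compact_dominating F /\
   has_invariant_compact F).
Proof.
have hX := multimetric_hausdorff D_multimetric X_canonical.
have dom6 : compact_dominating F -> has_invariant_compact F.
  have [x _] := X_nonempty.
  move=> /(_ _ (@compact_set1 _ x))[K [cK xK FK]].
  by exists K; split => //; exists x; exact: xK.
have all6 : has_invariant_compact F -> [/\ topologically_contracting F,
    compactly_contracting F, locally_contracting F, has_attractor F
    & compact_dominating F].
  move=> F6.
  have F3 := invariant_compact_locally_contracting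
    D_multimetric X_canonical F_contracting F6.
  have F2 := locally_compactly_contracting F3.
  have F1 := compactly_contracting_topologically hX F2.
  by split => //; [exact: compactly_contracting_attractor|exact: F1.1].
split.
  tfae.
  - by move=> [/dom6/all6[]].
  - by move=> [/all6[]].
  - by move=> [/all6[]].
  - move=> [A [FA _]]; have := all6; case=> //.
    exists A; split; [exact: hyper_nonempty|exact: hyper_compact|by rewrite FA].
  - exact: dom6.
  - by case/all6.
move=> Dcomp; have F6 : has_invariant_compact F.
  exact: (complete_invariant_compact (D := D)).
by have [? ? ? ? ?] := all6 F6.
Qed.
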